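(* Let $f,g:Q\to\mathbb{R}$ be convex functions such that, for all $x,y\in Q$, $$f(x)+\psi_f(y,x)\le f(y),\qquad -\psi_f(y,x)\le \phi_f^{-1}(V_d(y,x))+\delta,$$ $$g(x)+\psi_g(y,x)\le g(y),\qquad -\psi_g(y,x)\le \phi_g^{-1}(V_d(y,x))+\delta,$$ where $\psi_f(y,x),\psi_g(y,x)$ are convex in $y$ and $\psi_f(x,x)=\psi_g(x,x)=0$ for every $x\in Q$. Let $\varepsilon>0$, $\delta>0$ be fixed positive numbers, let $x^*$ be a solution of $\min\{f(x):x\in Q,\ g(x)\le 0\}$, and let $\Theta_0>0$ be a known constant such that $d(x^* )\le\Theta_0^2$. Then, after the stopping of Algorithm A (described in the context), its output $\widehat{x}$ satisfies $$f(\widehat{x})-f(x^* )\le\varepsilon+\delta\quad\text{and}\quad g(\widehat{x})\le\varepsilon+\delta.$$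
   Context: $(E,\|\cdot\|)$ is a finite-dimensional normed space, $Q\subset E$ is a closed convex set, and $f,g:Q\to\mathbb{R}$ are subdifferentiable. The reference function $d:Q\to\mathbb{R}$ is any convex (not necessarily strongly convex) differentiable function. The Bregman divergence is $V_d(y,x)=d(y)-d(x)-\langle\nabla d(x),y-x\rangle$ for $x,y\in Q$. The functions $\phi_f,\phi_g:\mathbb{R}\to\mathbb{R}$ are strictly increasing with $\phi_f(0)=\phi_g(0)=0$; $\phi_f^{-1},\phi_g^{-1}$ are their inverse functions, and $\phi_f^*,\phi_g^*$ are their conjugate functions, $\phi^*(s)=\sup_{t}\{st-\phi(t)\}$. Proximal mapping: for $h>0$, $\mathrm{Mirr}_h(x,\psi)=\arg\min_{y\in Q}\{\psi(y,x)+\frac1h V_d(y,x)\}$. Algorithm A. Input: $\varepsilon>0$, $\delta>0$, $h^f>0$, $h^g>0$, $\Theta_0$ with $d(x^* )\le\Theta_0^2$. Start from $x^0=\arg\min_{x\in Q}d(x)$, $I=J=\emptyset$, $N=0$. Repeat: if $g(x^N)\le\varepsilon+\delta$, set $x^{N+1}=\mathrm{Mirr}_{h^f}(x^N,\psi_f)$ and add $N$ to $I$ (productive step); otherwise set $x^{N+1}=\mathrm{Mirr}_{h^g}(x^N,\psi_g)$ and add $N$ to $J$ (non-productive step); then increase $N$ by 1; until $$\Theta_0^2\le\varepsilon\left(|J|h^g+|I|h^f\right)-|J|\phi_g^*(h^g)-|I|\phi_f^*(h^f).$$ Output $\widehat{x}=\frac1{|I|}\sum_{k\in I}x^k$.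
   Formalization: The formal theorem additionally assumes d ≥ 0 on Q (i.e. d(x^0) ≥ 0); without this normalization d(x* ) ≤ Θ_0² does not bound V_d(x*, x^0), and the claim fails, e.g. for d(x) = x²/2 − 1000 on [−1,1] with f(x) = −x, g = −1. *)

(* Defs.v *)
From HB Require Import structures.
From mathcomp Require Import all_boot all_order all_algebra.
From mathcomp Require Import all_classical all_reals all_analysis.

Set Implicit Arguments.
Unset Strict Implicit.
Unset Printing Implicit Defensive.

Import Order.TTheory GRing.Theory Num.Theory.
Import numFieldNormedType.Exports.

Local Open Scope classical_set_scope.
Local Open Scope ring_scope.

#[short(type="normedVectType")]
HB.structure Definition NormedVector (R : numFieldType) :=
  {E of NormedModule R E & Vector R E}.

(* A function defined on a subset Q of E is represented by a total function of
   which only the values on Q are constrained. *)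

Section ConvexAnalysis.
Context {R : realType} {E : normedVectType R}.
Implicit Types (Q : set E) (F d : E -> R) (dd : E -> {scalar E}) (x y : E).

Definition argmin Q F : set E :=
  [set x | Q x /\ forall y, Q y -> F x <= F y].

Definition subdifferential Q F x : set {scalar E} :=
  [set p : {scalar E} | forall y, Q y -> F x + p (y - x) <= F y].

Definition subdifferentiable_on Q F : Prop :=
  forall x, Q x -> subdifferential Q F x !=set0.

(* Frechet differentiability relative to Q, so that points of Q that are not
   interior are allowed.  The functional [dd x] may then fail to be unique, but
   for convex Q its values on the differences [y - x] with [y] in Q are. *)
Definition is_gradient_on Q d dd : Prop :=
  forall x, Q x -> let F := within Q (nbhs x) in
    (fun y => d y - d x - dd x (y - x) : R^o) =o_F (fun y => y - x).

Definition bregman d dd y x : R := d y - d x - dd x (y - x).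

(* Minimizers need not be unique: the proximal mapping is set-valued. *)
Definition mirr Q d dd (h : R) (psi : E -> E -> R) x : set E :=
  argmin Q (fun y => psi y x + h^-1 * bregman d dd y x).

End ConvexAnalysis.

Section ScalarFunctions.
Context {R : realType}.
Implicit Types phi : R -> R.

(* The inverse of an injective phi, meaningful on [range phi] only. *)
Definition inv_fun phi : R -> R := 'pinv_(fun=> 0) [set: R] phi.

(* The supremum may be +oo, whence the extended-real codomain. *)
Definition fconj phi (s : R) : \bar R :=
  ereal_sup (range (fun t : R => (s * t - phi t)%:E)).

End ScalarFunctions.

Section Algorithm.
Context {R : realType} {E : normedVectType R}.
Variables (Q : set E) (d : E -> R) (dd : E -> {scalar E}) (g : E -> R).
Variables (psi_f psi_g : E -> E -> R) (phi_f phi_g : R -> R).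
Variables (eps delta hf hg Theta0 : R).
Variable x : nat -> E.

Definition productive (N : nat) : {set 'I_N} :=
  [set k : 'I_N | g (x k) <= eps + delta]%SET.

Definition nonproductive (N : nat) : {set 'I_N} := (~: productive N)%SET.

(* In [\bar R] one has [0 * +oo = 0]: a kind of step that was never made does
   not contribute, even when the corresponding conjugate is infinite. *)
Definition stopping_criterion (N : nat) : Prop :=
  ((Theta0 ^+ 2)%:E <=
     (eps * (#|nonproductive N|%:R * hg + #|productive N|%:R * hf))%:E
     - (#|nonproductive N|%:R)%:E * fconj phi_g hg
     - (#|productive N|%:R)%:E * fconj phi_f hf)%E.

(* [x 0, ..., x N] are iterates of the algorithm and the repeat-until loop,
   whose test comes after the body, exits after exactly N iterations. *)
Definition stops_after (N : nat) : Prop :=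
  [/\ argmin Q d (x 0%N),
      forall k : nat, (k < N)%N ->
        if g (x k) <= eps + delta
        then mirr Q d dd hf psi_f (x k) (x k.+1)
        else mirr Q d dd hg psi_g (x k) (x k.+1),
      (0 < N)%N,
      forall M : nat, (0 < M < N)%N -> ~ stopping_criterion M
    & stopping_criterion N].

Definition output (N : nat) : E :=
  (#|productive N|%:R)^-1 *: \sum_(k in productive N) x k.

End Algorithm.

(* Main.v *)
(* Put V k := V_d(xstar, x^k).  First-order optimality of a mirror step, the
   three-point identity of the Bregman divergence and the Young inequality
   h t - phi t <= phi^*(h) at t = phi^-1(V_d(x^{k+1}, x^k)) bound the increment:
     V (k+1) - V k <= h psi(xstar, x^k) + h delta + phi^*(h).
   The lower bounds on f and g turn psi(xstar, x^k) into f(xstar) - f(x^k) on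
   productive steps, and into a number < - (eps + delta) on the others.  Summing,
   with V 0 <= d(xstar) <= Theta0^2 and V N >= 0, the stopping criterion says
   exactly that the weighted sum over all steps of f(x^k) - f(xstar) - delta - eps
   (productive, weight hf) and g(x^k) - delta - eps (nonproductive, weight hg) is
   at most 0.  The latter terms are positive, so there is a productive step and
   the productive part is at most 0; Jensen's inequality concludes. *)

Require Import Defs.
From mathcomp Require Import all_boot all_order all_algebra.
From mathcomp Require Import all_classical all_reals all_analysis.
From mathcomp Require Import ring lra.

Set Implicit Arguments.
Unset Strict Implicit.
Unset Printing Implicit Defensive.

Import Order.TTheory GRing.Theory Num.Theory.
Import numFieldNormedType.Exports.
Local Open Scope classical_set_scope.
Local Open Scope ring_scope.

(** * Segments in convex sets and Jensen's inequality for finite means *)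

Section Convexity.
Context {R : realType} {E : normedVectType R}.
Implicit Types (Q : set E) (F : E -> R).

Lemma convex_set_segment Q x y (t : R) : convex_set Q -> Q x -> Q y ->
  0 <= t <= 1 -> Q (x + t *: (y - x)).
Proof.
move=> Qc Qx Qy /andP[t0 t1].
have := Qc y x (Itv01 t0 t1) (mem_set Qy) (mem_set Qx).
rewrite inE; congr (Q _); rewrite /conv /=.
by rewrite scalerBr scalerBl scale1r addrCA addrA.
Qed.

Lemma convex_function_segment Q F x y (t : R) : convex_function Q F ->
  Q x -> Q y -> 0 <= t <= 1 ->
  F (x + t *: (y - x)) <= F x + t * (F y - F x).
Proof.
move=> Fc Qx Qy /andP[t0 t1].
have : F (t *: y + (1 - t) *: x) <= t * F y + (1 - t) * F x.
  exact: Fc (Itv01 t0 t1) y x (mem_set Qy) (mem_set Qx).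
rewrite (_ : t *: y + _ = x + t *: (y - x)); first by lra.
by rewrite scalerBr scalerBl scale1r addrCA addrA.
Qed.

(** Induction on [r]: the mean of n + 1 points lies on the segment from the mean of the last n to
    the first, at parameter 1 / (n + 1). *)
Lemma convex_mean Q F (I : Type) (x : I -> E) (r : seq I) :
  convex_set Q -> convex_function Q F -> (forall i, Q (x i)) ->
  (0 < size r)%N ->
  Q ((size r)%:R^-1 *: \sum_(i <- r) x i) /\
  F ((size r)%:R^-1 *: \sum_(i <- r) x i) <=
    (size r)%:R^-1 * \sum_(i <- r) F (x i).
Proof.
move=> Qc Fc Qx; elim: r => // i [|j r] IH _.
  by rewrite !big_seq1 invr1 scale1r mul1r.
have [//|Qm Fm] := IH.
rewrite big_cons [in leRHS]big_cons.
move: Qm Fm; set S := \sum_(k <- _) _; set T := \sum_(k <- _) _.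
set n := size (j :: r); rewrite -[size [:: i, j & r]]/n.+1 => Qm Fm.
have n0 : 0 < n%:R :> R by rewrite ltr0n.
have n1 : 0 < n.+1%:R :> R by rewrite ltr0n.
have t01 : 0 <= (n.+1%:R : R)^-1 <= 1.
  by rewrite invf_le1 // ler1n invr_ge0 ltW.
have meanE : n.+1%:R^-1 *: (x i + S) =
    n%:R^-1 *: S + n.+1%:R^-1 *: (x i - n%:R^-1 *: S).
  rewrite scalerBr scalerDr addrCA; congr (_ + _).
  rewrite scalerA -scalerBl; congr (_ *: _).
  by rewrite -natr1; field; rewrite natr1 !gt_eqF.
rewrite meanE; split; first exact: convex_set_segment.
apply: (le_trans (convex_function_segment Fc Qm (Qx i) t01)).
rewrite [leRHS](_ : _ = n%:R^-1 * T + n.+1%:R^-1 * (F (x i) - n%:R^-1 * T)).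
  case/andP: t01 => _ t1; move: t1 Fm.
  move: (n%:R^-1 * T) (n.+1%:R^-1 : R) (F _) => A t B t1 BA.
  by have : 0 <= (1 - t) * (A - B); [rewrite mulr_ge0 ?subr_ge0 | lra].
by rewrite -natr1; field; rewrite natr1 !gt_eqF.
Qed.

End Convexity.

(** * Young's inequality for the conjugate *)

Section Conjugate.
Context {R : realType}.

Lemma fconj_ge (phi : R -> R) s t : ((s * t - phi t)%:E <= fconj phi s)%E.
Proof. by apply: ereal_sup_ubound; exists t. Qed.

Lemma fconj_ge0 (phi : R -> R) s : phi 0 = 0 -> (0 <= fconj phi s)%E.
Proof. by move=> phi0; have := fconj_ge phi s 0; rewrite mulr0 phi0 subr0. Qed.

End Conjugate.

(** * First-order conditions relative to [Q] and the mirror step *)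

Section RelativeGradient.
Context {R : realType} {E : normedVectType R}.
Variables (Q : set E) (d : E -> R) (dd : E -> {scalar E}).
Hypotheses (Q_convex : convex_set Q) (d_grad : is_gradient_on Q d dd).

(** Differentiability relative to [Q] is used only along segments, which stay in [Q] by convexity. A
    single small t for each e is enough to pass to the limit in difference quotients. *)
Lemma gradient_segment x y (e : R) : Q x -> Q y -> 0 < e ->
  exists2 t : R, 0 < t <= 1 &
    `|d (x + t *: (y - x)) - d x - t * dd x (y - x)| <= t * e.
Proof.
move=> Qx Qy e0; set u := y - x.
(* Dividing by [|u| + 1] instead of [|u|] covers the case y = x. *)
have n0 : 0 < `|u| + 1 by rewrite ltr_wpDl.
have := d_grad Qx => /eqoP /(_ (e / (`|u| + 1)) (divr_gt0 e0 n0)).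
rewrite /prop_near1 /within /= -/(prop_near1 _) => /nbhs_ballP[r /= r0 H].
have t0 : 0 < Num.min 1 (r / (`|u| + 1)) / 2.
  by rewrite divr_gt0 // lt_min ltr01 divr_gt0.
set t := (X in 0 < X) in t0.
have t1 : t <= 1.
  have : Num.min 1 (r / (`|u| + 1)) <= 1 by rewrite ge_min lexx.
  by rewrite /t; lra.
have tr : t * (`|u| + 1) < r.
  rewrite -ltr_pdivlMr //.
  have : Num.min 1 (r / (`|u| + 1)) <= r / (`|u| + 1).
    by rewrite ge_min lexx orbT.
  by move: t0; rewrite /t; lra.
exists t; first by rewrite t0.
have := H (x + t *: u).
rewrite -ball_normE /= opprD addNKr normrN normrZ gtr0_norm //.
have ut : t * `|u| < r by move: tr; rewrite mulrDr mulr1; lra.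
have Qt : Q (x + t *: u) by apply: convex_set_segment; rewrite // (ltW t0).
move=> /(_ ut Qt).
have -> : x + t *: u - x = t *: u by rewrite addrC addKr.
rewrite linearZ /= normrZ gtr0_norm // => /le_trans; apply.
rewrite mulrCA ler_pM2l // mulrAC ler_pdivrMr // ler_pM2l //.
by rewrite lerDl.
Qed.

Lemma gradient_ge x y (c : R) : Q x -> Q y ->
  (forall t : R, 0 < t <= 1 -> t * c <= d (x + t *: (y - x)) - d x) ->
  c <= dd x (y - x).
Proof.
move=> Qx Qy H; apply/ler_addgt0Pr => e e0.
have [t /andP[t0 t1]] := gradient_segment Qx Qy e0.
rewrite ler_norml => /andP[_ dt].
have := H t; rewrite t0 t1 => /(_ isT) ct.
by rewrite -(ler_pM2l t0); lra.
Qed.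

Lemma gradient_le x y (c : R) : Q x -> Q y ->
  (forall t : R, 0 < t <= 1 -> d (x + t *: (y - x)) - d x <= t * c) ->
  dd x (y - x) <= c.
Proof.
move=> Qx Qy H; apply/ler_addgt0Pr => e e0.
have [t /andP[t0 t1]] := gradient_segment Qx Qy e0.
rewrite ler_norml => /andP[dt _].
have := H t; rewrite t0 t1 => /(_ isT) ct.
by rewrite -(ler_pM2l t0); lra.
Qed.

Lemma bregman_ge0 x y : convex_function Q d -> Q x -> Q y ->
  0 <= bregman d dd y x.
Proof.
move=> dc Qx Qy; rewrite /bregman subr_ge0.
apply: gradient_le => // t /andP[t0 t1].
by rewrite lerBlDl (convex_function_segment dc Qx Qy) ?(ltW t0).
Qed.

Lemma argmin_gradient_ge0 x y : argmin Q d x -> Q y -> 0 <= dd x (y - x).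
Proof.
move=> [Qx xmin] Qy; apply: gradient_ge => // t /andP[t0 t1].
by rewrite mulr0 subr_ge0 xmin //; apply: convex_set_segment; rewrite ?(ltW t0).
Qed.

Lemma bregman_three_points x y z :
  dd y (z - y) - dd x (z - y) =
  bregman d dd z x - bregman d dd z y - bregman d dd y x.
Proof.
rewrite /bregman.
have -> : z - x = (z - y) + (y - x) by rewrite addrA subrK.
by rewrite linearD /=; ring.
Qed.

(** Compare the minimizer y with y + t (z - y). Only d is differentiated: convexity bounds the
    change of [psi] by its chord, which leaves a lower bound on the difference quotients of d at
    y. *)
Lemma mirr_three_points (h : R) (psi : E -> E -> R) x y z : 0 < h -> Q x ->
  convex_function Q (psi^~ x) -> mirr Q d dd h psi x y -> Q z ->
  bregman d dd z y + bregman d dd y x + h * psi y x <=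
  bregman d dd z x + h * psi z x.
Proof.
move=> h0 Qx psic [Qy ymin] Qz.
suff : dd x (z - y) - h * (psi z x - psi y x) <= dd y (z - y).
  by have := bregman_three_points x y z; lra.
apply: gradient_ge => // t /andP[t0 t1].
have t01 : 0 <= t <= 1 by rewrite (ltW t0).
have psiw := convex_function_segment psic Qy Qz t01.
have Qw := convex_set_segment Q_convex Qy Qz t01.
have yw := ymin _ Qw; rewrite -(ler_pM2l h0) [leLHS]mulrDr [leRHS]mulrDr
  !mulVKf ?gt_eqF // in yw.
rewrite /= -(ler_pM2l h0) in psiw.
move: psiw yw; rewrite /bregman.
rewrite [y + _ - x](_ : _ = t *: (z - y) + (y - x)); last first.
  by rewrite [y + _]addrC addrA.
rewrite [dd x (_ + (y - x))]linearD [dd x (t *: _)]linearZ /=; lra.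
Qed.

Lemma mirr_step (h delta : R) phi (psi : E -> E -> R) x y z :
  0 < h -> Q x -> Q z -> convex_function Q (psi^~ x) ->
  range phi (bregman d dd y x) ->
  - psi y x <= inv_fun phi (bregman d dd y x) + delta ->
  fconj phi h \is a fin_num -> mirr Q d dd h psi x y ->
  bregman d dd z y <=
  bregman d dd z x + h * psi z x + h * delta + fine (fconj phi h).
Proof.
move=> h0 Qx Qz psic Vphi psiV fin ymirr.
have three := mirr_three_points h0 Qx psic ymirr Qz.
(* The range hypothesis makes [phi] undo [inv_fun phi] here, so Young's inequality produces exactly
   the divergence V(y, x) that the three-point inequality cancels. *)
have := fconj_ge phi h (inv_fun phi (bregman d dd y x)).
rewrite pinvK ?inE // -[leRHS](fineK fin) lee_fin => young.
by move: psiV; rewrite -(ler_pM2l h0); lra.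
Qed.

End RelativeGradient.

(* The hypothesis excludes an infinite [u] or [v], except against a zero
   coefficient; there [fine +oo = 0] and [0 * +oo = 0] agree. *)
Lemma sub_mule_fin (R : realType) (c a : R) (m n : nat) (u v : \bar R) :
  (0 <= u)%E -> (0 <= v)%E ->
  (a%:E <= c%:E - m%:R%:E * u - n%:R%:E * v)%E ->
  [/\ (0 < m)%N -> u \is a fin_num, (0 < n)%N -> v \is a fin_num
    & a <= c - m%:R * fine u - n%:R * fine v].
Proof.
have natoo k : (0 < k)%N -> (k%:R%:E * +oo = +oo :> \bar R)%E.
  by move=> k0; rewrite gt0_muley // lte_fin ltr0n.
case: u => [u||] // _; case: v => [v||] // _.
- case: n => [|n]; last by rewrite natoo.
  by rewrite mul0e -EFinM -!EFinB lee_fin /= !mulr0.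
- case: m => [|m]; last by rewrite natoo.
  by rewrite mul0e -EFinM -!EFinB lee_fin /= !mulr0.
- case: m => [|m]; last first.
    by rewrite natoo //; case: n => [|n]; rewrite ?mul0e ?natoo.
  case: n => [|n]; last by rewrite mul0e natoo.
  by rewrite !mul0e -!EFinB lee_fin /= !mulr0.
Qed.

(** * Summation along the run and averaging of the productive points *)

Theorem theorem1p1 (R : realType) (E : normedVectType R) (Q : set E)
  (f g d : E -> R) (dd : E -> {scalar E})
  (psi_f psi_g : E -> E -> R) (phi_f phi_g : R -> R)
  (eps delta hf hg Theta0 : R) (xstar : E) (x : nat -> E) (N : nat)
  (Q_closed : closed Q) (Q_convex : convex_set Q)
  (f_subdiff : subdifferentiable_on Q f)
  (g_subdiff : subdifferentiable_on Q g)
  (d_convex : convex_function Q d) (d_grad : is_gradient_on Q d dd)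
  (d_ge0 : forall y, Q y -> 0 <= d y)
  (phi_f_incr : {homo phi_f : s t / s < t}) (phi_f0 : phi_f 0 = 0)
  (phi_g_incr : {homo phi_g : s t / s < t}) (phi_g0 : phi_g 0 = 0)
  (phi_f_dom : forall x y, Q x -> Q y -> range phi_f (bregman d dd y x))
  (phi_g_dom : forall x y, Q x -> Q y -> range phi_g (bregman d dd y x))
  (f_convex : convex_function Q f) (g_convex : convex_function Q g)
  (f_lower : forall x y, Q x -> Q y -> f x + psi_f y x <= f y)
  (psi_f_bound : forall x y, Q x -> Q y ->
     - psi_f y x <= inv_fun phi_f (bregman d dd y x) + delta)
  (g_lower : forall x y, Q x -> Q y -> g x + psi_g y x <= g y)
  (psi_g_bound : forall x y, Q x -> Q y ->
     - psi_g y x <= inv_fun phi_g (bregman d dd y x) + delta)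
  (psi_f_convex : forall x, Q x -> convex_function Q (psi_f^~ x))
  (psi_g_convex : forall x, Q x -> convex_function Q (psi_g^~ x))
  (psi_f0 : forall x, Q x -> psi_f x x = 0)
  (psi_g0 : forall x, Q x -> psi_g x x = 0)
  (eps_gt0 : 0 < eps) (delta_gt0 : 0 < delta)
  (hf_gt0 : 0 < hf) (hg_gt0 : 0 < hg)
  (xstar_sol : argmin (Q `&` [set y | g y <= 0]) f xstar)
  (Theta0_gt0 : 0 < Theta0) (d_xstar : d xstar <= Theta0 ^+ 2)
  (x_run : stops_after Q d dd g psi_f psi_g phi_f phi_g
             eps delta hf hg Theta0 x N) :
  [/\ (0 < #|productive g eps delta x N|)%N,
      f (output g eps delta x N) - f xstar <= eps + delta
    & g (output g eps delta x N) <= eps + delta].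
Proof.
case: x_run => x0min step N_gt0 _ stop.
have [Qs gs] : Q xstar /\ g xstar <= 0 by case: xstar_sol => -[].
have Qx k : (k <= N)%N -> Q (x k).
  case: k => [_|k kN]; first by case: x0min.
  by have := step k kN; case: ifP => _ [].
have [fing finf] :=
  sub_mule_fin (fconj_ge0 _ phi_g0) (fconj_ge0 _ phi_f0) stop.
set P := productive g eps delta x N; set J := nonproductive _ _ _ _ _ in fing *.
set cg := fine _; set cf := fine _ => stopR.
pose V k := bregman d dd xstar (x k).
(* The decrease of [V] is split in two: [gain] depends only on the kind of step and sums to the
   right-hand side of the stopping criterion, [gap] carries the function values. *)
pose gap k := if g (x k) <= eps + delta
              then hf * (f (x k) - f xstar - delta - eps)
              else hg * (g (x k) - delta - eps).
pose gain k := if g (x k) <= eps + delta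
               then eps * hf - cf else eps * hg - cg.
have descent (k : 'I_N) : gap k + gain k <= V k - V k.+1.
  have kN := ltn_ord k.
  have [Qk Qk1] : Q (x k) /\ Q (x k.+1) by split; apply: Qx; rewrite // ltnW.
  have := step k kN; rewrite /gap /gain /V; case: ifP => gk xk1.
    (* The step k itself shows that its kind occurs, so the conjugate needed here is finite. *)
    have /finf fin : (0 < #|P|)%N by apply/card_gt0P; exists k; rewrite inE.
    have := mirr_step Q_convex d_grad hf_gt0 Qk Qs (psi_f_convex _ Qk)
      (phi_f_dom _ _ Qk Qk1) (psi_f_bound _ _ Qk Qk1) fin xk1.
    by have := f_lower _ _ Qk Qs; rewrite -(ler_pM2l hf_gt0) /cf; lra.
  have /fing fin : (0 < #|J|)%N.
    by apply/card_gt0P; exists k; rewrite !inE gk.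
  have := mirr_step Q_convex d_grad hg_gt0 Qk Qs (psi_g_convex _ Qk)
      (phi_g_dom _ _ Qk Qk1) (psi_g_bound _ _ Qk Qk1) fin xk1.
  have : g (x k) + psi_g xstar (x k) <= 0 by apply: le_trans gs; exact: g_lower.
  by rewrite -(ler_pM2l hg_gt0) mulr0 /cg; lra.
(* Optimality of [x 0] makes the linear term of [V 0] nonnegative, and [d_ge0] allows dropping
   [d (x 0)]; what remains is [d xstar]. *)
have V0 : V 0%N <= Theta0 ^+ 2.
  have := argmin_gradient_ge0 Q_convex d_grad x0min Qs.
  by have := d_ge0 _ (Qx 0%N isT); rewrite /V /bregman; lra.
have VN : 0 <= V N by apply: (bregman_ge0 Q_convex d_grad) => //; exact: Qx.
have gainE : \sum_(k < N) gain k =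
    eps * (#|J|%:R * hg + #|P|%:R * hf) - #|J|%:R * cg - #|P|%:R * cf.
  have -> : \sum_(k < N) gain k =
      \sum_(k in P) (eps * hf - cf) + \sum_(k in J) (eps * hg - cg).
    rewrite (bigID (mem P)) /=; congr (_ + _); apply: eq_big => k //.
    - by rewrite inE /gain => ->.
    - by rewrite !inE.
    - by rewrite inE /gain => /negbTE ->.
  rewrite !sumr_const -[(eps * hf - cf) *+ _]mulr_natr.
  by rewrite -[(eps * hg - cg) *+ _]mulr_natr; ring.
have gap_le0 : \sum_(k < N) gap k <= 0.
  have : \sum_(k < N) (gap k + gain k) <= \sum_(k < N) (V k - V k.+1).
    by apply: ler_sum => k _; exact: descent.
  rewrite big_split /= gainE.
  have -> : \sum_(k < N) (V k - V k.+1) = V 0%N - V N.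
    rewrite -(big_mkord predT (fun k => V k - V k.+1)) -[RHS]opprB.
    rewrite -telescope_sumr // -sumrN.
    by apply: eq_bigr => k _; rewrite opprB.
  by lra.
have gap_gt0 k : k \notin P -> 0 < gap k.
  rewrite inE /gap => gk; rewrite (negbTE gk); move: gk; rewrite -ltNge => gk.
  by rewrite mulr_gt0 //; lra.
have P_gt0 : (0 < #|P|)%N.
  rewrite lt0n; apply/negP => /eqP/card0_eq P0.
  have all_gt0 (k : 'I_N) : 0 < gap k by rewrite gap_gt0 ?P0.
  (* The loop body runs before the test, so N > 0 and step 0 provides a strictly positive term. *)
  move: gap_le0; rewrite (bigD1 (Ordinal N_gt0)) //= leNgt => /negP; apply.
  apply: ltr_wpDr (all_gt0 (Ordinal N_gt0)).
  by rewrite sumr_ge0 // => k _; exact: ltW.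
have P_le0 : \sum_(k in P) (f (x k) - f xstar - delta - eps) <= 0.
  rewrite -(pmulr_rle0 _ hf_gt0) mulr_sumr.
  rewrite (eq_bigr (fun k : 'I_N => gap k)); last by move=> k; rewrite inE /gap => ->.
  move: gap_le0; rewrite (bigID (mem P)) /=; apply: le_trans.
  by rewrite lerDl sumr_ge0 // => k /gap_gt0 /ltW.
have QxP (k : 'I_N) : Q (x k) by apply: Qx; exact: ltnW.
have size_gt0 : (0 < size (enum P))%N by rewrite -cardE.
have P_neq0 : 0 < #|P|%:R :> R by rewrite ltr0n.
have [_ fmean] := convex_mean Q_convex f_convex QxP size_gt0.
have [_ gmean] := convex_mean Q_convex g_convex QxP size_gt0.
move: fmean gmean; rewrite !big_enum -cardE => fmean gmean.
split => //.
- rewrite lerBlDr; apply: (le_trans fmean).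
  (* Clearing the factor 1 / [#|P|] turns the target bound into a constant sum over [P], comparable
     with [P_le0] term by term. *)
  rewrite mulrC ler_pdivrMr // -subr_le0; apply: le_trans P_le0.
  by rewrite mulr_natr -sumr_const -sumrB; apply: ler_sum => k _; lra.
- apply: (le_trans gmean); rewrite mulrC ler_pdivrMr // mulr_natr -sumr_const.
  by apply: ler_sum => k; rewrite inE.
Qed.
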